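(* Let $d\geq 1$, $m\geq 3$ and $s=2d+3$, and let $n$ be a positive multiple of $s$. Let $0\leq \ell<n$ and let $X=C_m\times^{\sigma_\ell} C_n$ be the direct graph bundle with base $C_m$, fibre $C_n$ and cyclic $\ell$-shift $\sigma_\ell$. Suppose that $\ell=[ks+(-1)^a 2m]\bmod n$ for some $a\in\{1,2\}$ and $k\in\mathbb{Z}$, or that $\ell=[ks-(-1)^a(d+1)m]\bmod n$ for some $a\in\{1,2\}$ and $k\in\mathbb{Z}$. Then $\lambda^d_1(X)\leq 2d+2$, and $\lambda^d_1(X)=2d+2$ if $1\leq d\leq 4$.
   Context: For $n\geq 3$, the cycle $C_n$ has vertex set $\{0,1,\dots,n-1\}$ with $i$ adjacent to $j$ iff $i\equiv j\pm 1 \pmod n$. The cyclic $\ell$-shift is the automorphism $\sigma_\ell(j)=(j+\ell)\bmod n$ of $C_n$. The direct graph bundle $C_m\times^{\sigma_\ell}C_n$ has vertex set $\{0,\dots,m-1\}\times\{0,\dots,n-1\}$; for $0\leq i\leq m-2$ and every edge $j_1j_2$ of $C_n$, the vertices $(i,j_1)$ and $(i+1,j_2)$ are adjacent; and for every edge $j_1j_2$ of $C_n$, the vertices $(m-1,j_1)$ and $(0,\sigma_\ell(j_2))$ are adjacent; there are no other edges. (For $\ell=0$ this is the direct product $C_m\times C_n$.) For an integer $d\geq 1$, an $L(d,1)$-labeling of a graph $G$ is a map $f:V(G)\to\{0,1,2,\dots\}$ such that $|f(u)-f(v)|\geq d$ whenever $u,v$ are adjacent and $|f(u)-f(v)|\geq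 1$ whenever $u,v$ are at distance $2$ in $G$. $\lambda^d_1(G)$ is the least $\lambda$ such that $G$ admits an $L(d,1)$-labeling with labels in $\{0,1,\dots,\lambda\}$. *)

(* Defs.v *)
From mathcomp Require Import all_boot all_order all_algebra.

Set Implicit Arguments.
Unset Strict Implicit.
Unset Printing Implicit Defensive.

Import IntDist.

(* The second disjunct encodes i = j - 1 modulo n without truncated subtraction. *)
Definition cycle_adj (n : nat) : rel 'I_n :=
  fun i j => (i == j + 1 %[mod n]) || (i + 1 == j %[mod n]).

Definition cyclic_shift (n l : nat) (j : 'I_n) : 'I_n :=
  Ordinal (ltn_pmod (j + l) (leq_ltn_trans (leq0n j) (ltn_ord j))).

(* The edges of the bundle, oriented along the base cycle 0 -> 1 -> ... -> 0. *)
Definition bundle_arc (m n : nat) (sigma : 'I_n -> 'I_n) :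
    rel ('I_m * 'I_n) :=
  fun u v =>
    ((u.1 + 1 == v.1 :> nat) && cycle_adj u.2 v.2)
    || [&& u.1 == m - 1 :> nat, v.1 == 0 :> nat &
        [exists j2 : 'I_n, cycle_adj u.2 j2 && (v.2 == sigma j2)]].

Definition direct_bundle (m n : nat) (sigma : 'I_n -> 'I_n) :
    rel ('I_m * 'I_n) :=
  fun u v => bundle_arc sigma u v || bundle_arc sigma v u.

Section Labelings.
Variables (V : finType) (adj : rel V).

(* [p] lists the vertices of a walk after [u], so [size p] is its length. *)
Definition at_distance (k : nat) (u v : V) : Prop :=
  (exists p : seq V, [/\ path adj u p, last u p = v & size p = k]) /\
  (forall p : seq V, path adj u p -> last u p = v -> k <= size p).

Definition Ld1_labeling (d : nat) (f : V -> nat) : Prop :=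
  (forall u v, adj u v -> d <= `|f u - f v|) /\
  (forall u v, at_distance 2 u v -> 1 <= `|f u - f v|).

Definition has_Ld1_labeling (d lam : nat) : Prop :=
  exists f : V -> nat, Ld1_labeling d f /\ (forall v, f v <= lam).

(* Relational form of lambda^d_1(G) = lam: lam is the least admissible span. *)
Definition is_lambda_d1 (d lam : nat) : Prop :=
  has_Ld1_labeling d lam /\
  (forall mu, has_Ld1_labeling d mu -> lam <= mu).

End Labelings.

(* Main.v *)
(** Label the vertex (i, j) by the residue of [alpha * i + beta * j] modulo
    s = 2d + 3, where {|alpha|, |beta|} = {1, d + 1}.  Along an edge the form
    changes by [alpha + beta] or [alpha - beta] up to sign, hence by d or d + 2
    in absolute value, which separates the residues by at least d.  The four
    changes at a vertex are distinct modulo s, so its neighbours get distinct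
    labels.  The form is well defined around the base cycle iff
    [beta * l = alpha * m] modulo s: for [beta = 1] this is
    [l = +-(d + 1) m], and for [beta = d + 1], the inverse of -2, it is
    [l = +-2m].

    Conversely, with labels at most 2d + 1, the four neighbours of a vertex
    labelled x need distinct labels at distance at least d from x, which forces
    x <= d - 2 or x >= d + 3.  This holds at every vertex, so the neighbours of
    a low vertex are all high and vice versa; but each class has only
    d - 1 < 4 labels when d <= 4. *)

Require Import Defs.
From mathcomp Require Import all_boot all_order all_algebra.
From mathcomp Require Import zify ring.
From Stdlib Require Import Classical.

Set Implicit Arguments.
Unset Strict Implicit.
Unset Printing Implicit Defensive.

Import GRing.Theory IntDist.

(** * Integer equations for the arcs of the bundle *)

Section Lifting.
Local Open Scope ring_scope.

Lemma eqn_mod_intP (a b n : nat) :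
  (a = b %[mod n])%N <-> exists q : int, a%:Z = b%:Z + q * n%:Z.
Proof.
split=> [/eqP|[q abq]].
  rewrite -eqz_nat -!modz_nat eqz_mod_dvd => /dvdzP[q abq].
  by exists q; rewrite -abq addrC subrK.
apply/eqP; rewrite -eqz_nat -!modz_nat eqz_mod_dvd; apply/dvdzP; exists q.
by rewrite abq addrC addKr.
Qed.

Lemma ord_of_int (n : nat) (x : int) :
  (0 < n)%N -> exists (j : 'I_n) (q : int), j%:Z = x + q * n%:Z.
Proof.
move=> n_gt0; have n_neq0 : n%:Z != 0 by lia.
have r_ge0 := modz_ge0 x n_neq0.
have r_lt : (x %% n%:Z)%Z < n%:Z by apply: ltz_pmod; lia.
have r_ltn : (`|(x %% n%:Z)%Z|%N < n)%N by lia.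
exists (Ordinal r_ltn), (- (x %/ n%:Z)%Z) => /=.
have := divz_eq x n%:Z; lia.
Qed.

(* [c] records whether the arc crosses from fibre [m - 1] to fibre [0]. *)
Definition lifted_arc (m n l : nat) (y : int) (u v : 'I_m * 'I_n) : Prop :=
  exists c q : int, [/\ c = 0 \/ c = 1, v.1%:Z = u.1%:Z + 1 - c * m%:Z
    & v.2%:Z = u.2%:Z + y + c * l%:Z + q * n%:Z].

Lemma cycle_adjP (n : nat) (i j : 'I_n) :
  cycle_adj i j <->
  exists y q : int, (y = 1 \/ y = -1) /\ j%:Z = i%:Z + y + q * n%:Z.
Proof.
rewrite /cycle_adj; split.
  case/orP => /eqP/eqn_mod_intP[q e].
    by exists (-1), (- q); split; [right|lia].
  by exists 1, (- q); split; [left|lia].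
case=> y [q [[]-> e]]; apply/orP; [right|left]; apply/eqP/eqn_mod_intP;
  exists (- q); lia.
Qed.

(** Trades the modular conditions and the existential over [j2] for linear equations over the
    integers; [y] is the direction of the step in the fibre. *)
Lemma bundle_arcP (m n l : nat) (u v : 'I_m * 'I_n) :
  bundle_arc (@cyclic_shift n l) u v <->
  exists2 y : int, y = 1 \/ y = -1 & lifted_arc l y u v.
Proof.
have [u1m v1m] := (ltn_ord u.1, ltn_ord v.1).
rewrite /bundle_arc; split.
  case/orP=> [/andP[/eqP uv1 /cycle_adjP[y [q [yE e]]]]|].
    exists y => //; exists 0, q; split; [by left|lia|lia].
  case/and3P=> /eqP u1 /eqP v1 /existsP[j /andP[/cycle_adjP[y [q [yE e]]]]].
  move=> /eqP v2; have /eqn_mod_intP[q' e'] : (v.2 = j + l %[mod n])%N.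
    by rewrite v2 /= modn_mod.
  exists y => //; exists 1, (q + q'); split; [by right|lia|].
  by rewrite e' PoszD e; ring.
case=> y yE [c [q [cE v1 v2]]]; apply/orP; case: cE => cE; subst c.
  left; apply/andP; split; first by apply/eqP; lia.
  by apply/cycle_adjP; exists y, q; split=> //; lia.
right; have n_gt0 : (0 < n)%N by have := ltn_ord u.2; lia.
apply/and3P; split; try by apply/eqP; lia.
(* [j] is the end of the fibre step before the shift is applied. *)
have [j [q' jE]] := @ord_of_int n (u.2%:Z + y) n_gt0.
apply/existsP; exists j; apply/andP; split.
  by apply/cycle_adjP; exists y, q'.
apply/eqP/val_inj; rewrite /= -[LHS](modn_small (ltn_ord v.2)).
apply/eqn_mod_intP; exists (q - q'); rewrite PoszD v2 jE; ring.
Qed.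

Lemma ord_lift_inj (n : nat) (i j : 'I_n) (q : int) :
  i%:Z = j%:Z + q * n%:Z -> i = j.
Proof.
move=> e; apply: val_inj; rewrite /= -(modn_small (ltn_ord i)).
by rewrite -(modn_small (ltn_ord j)); apply/eqn_mod_intP; exists q.
Qed.

(** First coordinates lie in [[0, m)], so [u.1] determines [c]; the second coordinates are then
    congruent modulo [n]. *)
Lemma lifted_arc_injr (m n l : nat) (y : int) (u v w : 'I_m * 'I_n) :
  lifted_arc l y u v -> lifted_arc l y u w -> v = w.
Proof.
case: v w => [v1 v2] [w1 w2] [c [q [cE /= ev1 ev2]]] [c' [q' [c'E /= ew1 ew2]]].
have [v1m w1m] := (ltn_ord v1, ltn_ord w1).
have cc' : c = c' by case: cE c'E ev1 ew1 => -> [] ->; lia.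
subst c'; congr pair; first by apply: val_inj => /=; lia.
by apply: (@ord_lift_inj _ _ _ (q - q')); rewrite ev2 ew2; ring.
Qed.

Lemma lifted_arc_injl (m n l : nat) (y : int) (u v w : 'I_m * 'I_n) :
  lifted_arc l y v u -> lifted_arc l y w u -> v = w.
Proof.
case: v w => [v1 v2] [w1 w2] [c [q [cE /= ev1 ev2]]] [c' [q' [c'E /= ew1 ew2]]].
have [v1m w1m] := (ltn_ord v1, ltn_ord w1).
have cc' : c = c' by case: cE c'E ev1 ew1 => -> [] ->; lia.
subst c'; congr pair; first by apply: val_inj => /=; lia.
apply: (@ord_lift_inj _ _ _ (q' - q)).
have -> : v2%:Z = u.2%:Z - y - c * l%:Z - q * n%:Z by rewrite ev2; ring.
by rewrite ew2; ring.
Qed.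

Lemma lifted_arc_out (m n l : nat) (y : int) (u : 'I_m * 'I_n) :
  exists v, lifted_arc l y u v.
Proof.
have [u1m u2n] := (ltn_ord u.1, ltn_ord u.2).
have n_gt0 : (0 < n)%N by lia.
have [u1E|u1N] := eqVneq u.1.+1 m.
  have [j [q jE]] := @ord_of_int n (u.2%:Z + y + l%:Z) n_gt0.
  have m_gt0 : (0 < m)%N by lia.
  exists (Ordinal m_gt0, j), 1, q.
  by split; [right|rewrite /=; lia|rewrite /= mul1r].
have [j [q jE]] := @ord_of_int n (u.2%:Z + y) n_gt0.
have u1Sm : (u.1.+1 < m)%N by lia.
exists (Ordinal u1Sm, j), 0, q.
by split; [left|rewrite /=; lia|rewrite /= mul0r addr0].
Qed.

Lemma lifted_arc_in (m n l : nat) (y : int) (u : 'I_m * 'I_n) :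
  exists v, lifted_arc l y v u.
Proof.
have [u1m u2n] := (ltn_ord u.1, ltn_ord u.2).
have n_gt0 : (0 < n)%N by lia.
have [u1E|u1N] := eqVneq (u.1 : nat) 0%N.
  have [j [q jE]] := @ord_of_int n (u.2%:Z - y - l%:Z) n_gt0.
  have m_gt0 : (m.-1 < m)%N by lia.
  exists (Ordinal m_gt0, j), 1, (- q).
  by split; [right|rewrite /=; lia|rewrite /= jE; ring].
have [j [q jE]] := @ord_of_int n (u.2%:Z - y) n_gt0.
have u1Pm : (u.1.-1 < m)%N by lia.
exists (Ordinal u1Pm, j), 0, (- q).
by split; [left|rewrite /=; lia|rewrite /= jE; ring].
Qed.

End Lifting.

(** * Linear labelings modulo [2 * d + 3] *)

Section LinearLabeling.
Local Open Scope ring_scope.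

Variables (d m n l : nat) (alpha beta : int).
Local Notation s := (2 * d + 3)%N.
Local Notation sigma := (@cyclic_shift n l).

Definition linear_form (u : 'I_m * 'I_n) : int := alpha * u.1%:Z + beta * u.2%:Z.

Definition linear_labeling (u : 'I_m * 'I_n) : nat :=
  `|(linear_form u %% s%:Z)%Z|%N.

Lemma linear_labelingP u :
  (linear_labeling u <= 2 * d + 2)%N /\
  exists k : int, linear_form u = (linear_labeling u)%:Z + k * s%:Z.
Proof.
have s_neq0 : s%:Z != 0 by lia.
have r_ge0 := modz_ge0 (linear_form u) s_neq0.
have r_lt : (linear_form u %% s%:Z)%Z < s%:Z by apply: ltz_pmod; lia.
rewrite /linear_labeling; split; first by lia.
exists (linear_form u %/ s%:Z)%Z.
have := divz_eq (linear_form u) s%:Z; lia.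
Qed.

(** Since [d + (d + 3) = s], moving [t] by [s] towards and past zero keeps its absolute value in
    [[d, d + 3]]; any other nonzero [k] would give a difference above [2 * d + 2]. *)
Lemma residue_gap (a b : nat) (t k : int) :
  (a <= 2 * d + 2)%N -> (b <= 2 * d + 2)%N ->
  b%:Z = a%:Z + t + k * s%:Z -> d%:Z <= `|t| <= d%:Z + 3 ->
  (d <= `|a - b|)%N.
Proof.
move=> a_le b_le e t_bd.
have [k_le|[kE|[kE|[kE|k_ge]]]] :
  k <= -2 \/ k = -1 \/ k = 0 \/ k = 1 \/ 2 <= k by lia.
- nia.
- by subst k; lia.
- by subst k; lia.
- by subst k; lia.
- nia.
Qed.

Lemma small_multiple (t k : int) :
  t = k * s%:Z -> `|t| < 2 * s%:Z -> `|t| <> s%:Z -> t = 0.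
Proof.
move=> -> kb kN.
have [k_le|[k1|[k0|[k1|k_ge]]]] :
  k <= -2 \/ k = -1 \/ k = 0 \/ k = 1 \/ 2 <= k by lia.
- nia.
- by move: kN; rewrite k1; lia.
- by rewrite k0 mul0r.
- by move: kN; rewrite k1; lia.
- nia.
Qed.

Hypothesis d_gt0 : (0 < d)%N.
Hypothesis s_dvd_n : (s %| n)%N.
Hypothesis coefE :
  `|alpha| = 1 /\ `|beta| = d%:Z + 1 \/ `|alpha| = d%:Z + 1 /\ `|beta| = 1.
Hypothesis closing : exists k : int, beta * l%:Z = alpha * m%:Z + k * s%:Z.

(** Two corrections vanish modulo [s]: wrapping around the fibre, as [s] divides [n], and crossing
    the seam of the base, by [closing]. *)
Lemma lifted_arc_labeling (y : int) (u v : 'I_m * 'I_n) :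
  lifted_arc l y u v -> exists k : int,
  (linear_labeling v)%:Z = (linear_labeling u)%:Z + alpha + y * beta + k * s%:Z.
Proof.
case=> c [q [_ v1 v2]].
have [_ [ku ue]] := linear_labelingP u; have [_ [kv ve]] := linear_labelingP v.
have /dvdnP[t nE] := s_dvd_n; have [k kE] := closing.
have -> : (linear_labeling v)%:Z = linear_form v - kv * s%:Z by rewrite ve; ring.
have -> : (linear_labeling u)%:Z = linear_form u - ku * s%:Z by rewrite ue; ring.
rewrite /linear_form v1 v2; exists (ku - kv + c * k + beta * q * t%:Z).
have -> : n%:Z = t%:Z * s%:Z by rewrite nE PoszM.
rewrite !mulrDr [beta * (c * _)]mulrCA kE; ring.
Qed.

Lemma linear_labeling_nbr_inj (w u v : 'I_m * 'I_n) :
  direct_bundle sigma w u -> direct_bundle sigma w v ->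
  linear_labeling u = linear_labeling v -> u = v.
Proof.
(* These are the possible differences between the changes towards two neighbours. They are nonzero
   as [d > 0], below [2 * s] in size, and even whereas [s] is odd. *)
have step2N0 (z t : int) : t = 2 * beta \/ t = 2 * alpha
    \/ t = 2 * alpha + 2 * beta \/ t = 2 * alpha - 2 * beta -> t <> z * s%:Z.
  move=> tE /small_multiple; move: coefE; lia.
move=> wu wv uv.
case/orP: wu => /bundle_arcP[y yE wu]; have [k ek] := lifted_arc_labeling wu;
case/orP: wv => /bundle_arcP[z zE wv]; have [k' ek'] := lifted_arc_labeling wv.
- case: yE zE ek ek' wu wv => -> [] -> ek ek' wu wv.
  + exact: lifted_arc_injr wu wv.
  + by case: (@step2N0 (k' - k) (2 * beta)); [tauto|lia].
  + by case: (@step2N0 (k - k') (2 * beta)); [tauto|lia].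
  + exact: lifted_arc_injr wu wv.
(* Here [u] follows [w] and [v] precedes it, so the [alpha] terms add up instead of cancelling. *)
- have : 2 * alpha + (y + z) * beta = - (k + k') * s%:Z by lia.
  by case: yE zE => -> [] -> e; case: (step2N0 _ _ _ e); lia.
- have : 2 * alpha + (y + z) * beta = - (k + k') * s%:Z by lia.
  by case: yE zE => -> [] -> e; case: (step2N0 _ _ _ e); lia.
- case: yE zE ek ek' wu wv => -> [] -> ek ek' wu wv.
  + exact: lifted_arc_injl wu wv.
  + by case: (@step2N0 (k' - k) (2 * beta)); [tauto|lia].
  + by case: (@step2N0 (k - k') (2 * beta)); [tauto|lia].
  + exact: lifted_arc_injl wu wv.
Qed.

Lemma linear_labeling_Ld1 :
  Ld1_labeling (direct_bundle sigma) d linear_labeling.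
Proof.
have arc_gap u v : bundle_arc sigma u v ->
    (d <= `|linear_labeling u - linear_labeling v|)%N.
  case/bundle_arcP=> y yE /lifted_arc_labeling[k e].
  have [uB _] := linear_labelingP u; have [vB _] := linear_labelingP v.
  apply: (@residue_gap _ _ (alpha + y * beta) k) => //; first by lia.
  move: coefE; case: yE => ->; rewrite ?mul1r ?mulN1r => -[] [aE bE];
    by apply/andP; split; lia.
split=> [u v /orP[/arc_gap//|/arc_gap]|u v [[p [uwv lastE p2]] min2]].
  by lia.
(* If [u = v], the empty walk would contradict the distance being 2. *)
have uv : u <> v by move=> uv; have := min2 [::] isT uv.
case: p p2 uwv lastE => [|w [|v' []]] //= _ /and3P[uw wv _] v'v.
rewrite {v'}v'v in wv.
have wu : direct_bundle sigma w u by rewrite /direct_bundle orbC.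
have [|fuv] := eqVneq (linear_labeling u) (linear_labeling v); last by lia.
by move/(linear_labeling_nbr_inj wu wv)/uv.
Qed.

End LinearLabeling.

(** * Lower bound from vertices with four neighbours *)

Section LowerBound.
Local Open Scope ring_scope.

(** Either [u] and [v] are adjacent, and [d > 0] separates their labels, or the walk through [w]
    puts them at distance 2. *)
Lemma nbr_labels_distinct (V : finType) (adj : rel V) (d : nat) (f : V -> nat)
    (w u v : V) :
  symmetric adj -> (0 < d)%N -> Ld1_labeling adj d f ->
  adj w u -> adj w v -> u <> v -> f u <> f v.
Proof.
move=> adjC d_gt0 [f1 f2] wu wv uv fuv.
have [uv_adj|uv_nadj] := boolP (adj u v); first by have := f1 _ _ uv_adj; lia.
suff /f2 : at_distance adj 2 u v by lia.
split; first by exists [:: w; v]; rewrite /= (adjC u) wu wv.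
case=> [|x [|y p]] //= /andP[ux _] xv.
by rewrite -xv ux in uv_nadj.
Qed.

Lemma direct_bundleC (m n : nat) (sigma : 'I_n -> 'I_n) :
  symmetric (@direct_bundle m n sigma).
Proof. by move=> u v; rewrite /direct_bundle orbC. Qed.

Lemma bundle_four_nbrs (m n l : nat) (u : 'I_m * 'I_n) :
  (3 <= m)%N -> (3 <= n)%N -> exists s : seq ('I_m * 'I_n),
  [/\ uniq s, size s = 4%N & all (direct_bundle (@cyclic_shift n l) u) s].
Proof.
move=> m_ge3 n_ge3.
have [a ua] := lifted_arc_out l 1 u; have [b ub] := lifted_arc_out l (-1) u.
have [a' au] := lifted_arc_in l 1 u; have [b' bu] := lifted_arc_in l (-1) u.
(* The two fibre directions differ by 2, which is nonzero modulo [n]. *)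
have small_ndvd (q : int) : 2 <> q * n%:Z.
  have [q_le|[->|q_ge]] : q <= -1 \/ q = 0 \/ 1 <= q by lia.
  - nia.
  - by rewrite mul0r.
  - nia.
(* The next and the previous fibre differ because [m >= 3]. *)
have opposite_fibres (y z : int) v w :
    lifted_arc l y u v -> lifted_arc l z w u -> v != w.
  move=> [c [q [cE v1 v2]]] [c' [q' [c'E u1 u2]]].
  apply/eqP=> vw; rewrite -vw in u1; have [u1m v1m] := (ltn_ord u.1, ltn_ord v.1).
  by case: cE c'E v1 u1 => -> [] ->; lia.
exists [:: a; b; a'; b']; split=> //=; last first.
  rewrite /direct_bundle; apply/and5P; split=> //; apply/orP;
    [left|left|right|right]; apply/bundle_arcP.
  - by exists 1; [left|].
  - by exists (-1); [right|].
  - by exists 1; [left|].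
  - by exists (-1); [right|].
rewrite !inE !negb_or (opposite_fibres _ _ _ _ ua au) (opposite_fibres _ _ _ _ ua bu).
rewrite (opposite_fibres _ _ _ _ ub au) (opposite_fibres _ _ _ _ ub bu) !andbT /=.
apply/andP; split; apply/eqP.
  move=> ab; subst b; case: ua ub => c [q [cE a1 a2]] [c' [q' [c'E b1 b2]]].
  have cc' : c = c' by case: cE c'E a1 b1 => -> [] ->; lia.
  by subst c'; apply: (small_ndvd (q' - q)); lia.
move=> ab; subst b'; case: au bu => c [q [cE a1 a2]] [c' [q' [c'E b1 b2]]].
have [u1m a1m] := (ltn_ord u.1, ltn_ord a'.1).
have cc' : c = c' by case: cE c'E a1 b1 => -> [] ->; lia.
by subst c'; apply: (small_ndvd (q' - q)); lia.
Qed.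

End LowerBound.

(** For [d - 1 <= x <= d + 2] at most three labels are available: [x - d + 1] below [x] and
    [d + 2 - x] above it. *)
Lemma label_extremal (d x a b c e : nat) :
  uniq [:: a; b; c; e] -> all (fun y : nat => d <= `|x - y|) [:: a; b; c; e] ->
  x <= 2 * d + 1 -> all (fun y => y <= 2 * d + 1) [:: a; b; c; e] ->
  x + 2 <= d \/ d + 3 <= x.
Proof.
rewrite /= !inE !negb_or !andbT.
case/and3P=> /and3P[ab ac ae] /andP[bc be] ce.
case/and4P=> xa xb xc xe x_le /and4P[a_le b_le c_le e_le].
lia.
Qed.

Lemma Ld1_span_lower_bound (V : finType) (adj : rel V) (d mu : nat) (u0 : V) :
  symmetric adj -> 1 <= d <= 4 ->
  (forall u, exists s : seq V, [/\ uniq s, size s = 4 & all (adj u) s]) ->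
  has_Ld1_labeling adj d mu -> 2 * d + 2 <= mu.
Proof.
move=> adjC /andP[d_gt0 d_le4] nbrs [f [fL f_le]].
rewrite leqNgt; apply/negP=> mu_lt.
have nbr_labels u : exists s : seq V, [/\ size s = 4, all (adj u) s &
    uniq (map f s)].
  have [s [s_uniq s4 us]] := nbrs u; exists s; split=> //.
  rewrite map_inj_in_uniq // => v w vs ws fvw.
  apply/eqP/negPn/negP=> /eqP vw.
  by apply: (nbr_labels_distinct adjC d_gt0 fL _ _ vw fvw);
    apply: (allP us).
have f_bd u : f u <= 2 * d + 1 by have := f_le u; lia.
have extremal u : f u + 2 <= d \/ d + 3 <= f u.
  have [[|a [|b [|c [|e [|? ?]]]]] [] //= _] := nbr_labels u.
  case/and5P=> ua ub uc ue _ fs.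
  apply: label_extremal fs _ _ _.
  - by rewrite /= !(fL.1 u).
  - exact: f_bd.
  - by rewrite /= !f_bd.
have [[|a [|b [|c [|e [|? ?]]]]] [] //= _] := nbr_labels u0.
case/and5P=> ua ub uc ue _.
have ga := fL.1 _ _ ua; have gb := fL.1 _ _ ub.
have gc := fL.1 _ _ uc; have ge := fL.1 _ _ ue.
have [lu [la [lb [lc le]]]] := (f_bd u0, (f_bd a, (f_bd b, (f_bd c, f_bd e)))).
rewrite !inE !negb_or !andbT => /and3P[/and3P[ab ac ae] /andP[bc be] ce].
(* Two labels of the same class differ by at most [d - 2], so all four neighbours fall in the class
   opposite to [u0]. *)
case: (extremal u0) (extremal a) (extremal b) (extremal c) (extremal e)
  => xu [] xa [] xb [] xc [] xe; lia.
Qed.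

(** * The least span, and the two families of shifts *)

Lemma ex_is_lambda_d1 (V : finType) (adj : rel V) (d mu : nat) :
  has_Ld1_labeling adj d mu ->
  exists2 lam, is_lambda_d1 adj d lam & lam <= mu.
Proof.
elim/ltn_ind: mu => mu IH mu_lab.
have [[nu nu_lt nu_lab]|no_smaller] :=
  classic (exists2 nu, nu < mu & has_Ld1_labeling adj d nu).
  have [lam lamP lam_le] := IH nu nu_lt nu_lab.
  by exists lam => //; lia.
exists mu => //; split=> // nu nu_lab; rewrite leqNgt; apply/negP=> nu_lt.
by apply: no_smaller; exists nu.
Qed.

Theorem theorem1 (d m s n l : nat)
    (hd : 1 <= d) (hm : 3 <= m) (hs : s = 2 * d + 3)
    (hn : 0 < n) (hsn : s %| n) (hl : l < n)
    (hlk :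
      (exists (a : nat) (k : int), (a = 1 \/ a = 2) /\
         (l%:Z)%R = ((k * s%:Z + (-1) ^+ a * (2 * m)%:Z)%R %% (n%:Z)%R)%Z)
      \/
      (exists (a : nat) (k : int), (a = 1 \/ a = 2) /\
         (l%:Z)%R = ((k * s%:Z - (-1) ^+ a * ((d + 1) * m)%:Z)%R %% (n%:Z)%R)%Z)) :
  exists lam : nat,
    [/\ is_lambda_d1 (@direct_bundle m n (@cyclic_shift n l)) d lam,
        lam <= 2 * d + 2
      & (1 <= d <= 4 -> lam = 2 * d + 2)].
Proof.
subst s.
have /dvdnP[t nE] := hsn.
(* As [n = t * s], reduction modulo [n] changes [x] by a multiple of [s]. *)
have lift_l (x : int) : l%:Z%R = (x %% n%:Z)%Z ->
    exists q : int, (x = l%:Z + q * t%:Z * (2 * d + 3)%N%:Z)%R.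
  move=> lE; exists (x %/ n%:Z)%Z; rewrite -mulrA -PoszM -nE.
  by rewrite addrC [LHS](divz_eq x n%:Z) -lE.
have upper : has_Ld1_labeling (@direct_bundle m n (@cyclic_shift n l)) d (2 * d + 2).
  have lin (alpha beta : int) :
      (`|alpha| = 1 /\ `|beta| = d%:Z + 1 \/ `|alpha| = d%:Z + 1 /\ `|beta| = 1)%R ->
      (exists k : int, beta * l%:Z = alpha * m%:Z + k * (2 * d + 3)%N%:Z)%R ->
      has_Ld1_labeling (@direct_bundle m n (@cyclic_shift n l)) d (2 * d + 2).
    move=> coefE closing; exists (linear_labeling d alpha beta).
    split=> [|v]; first exact: linear_labeling_Ld1.
    by case: (linear_labelingP d alpha beta v).
  case: hlk => -[a [k [aE /lift_l[q e]]]].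
    (* From [2 * (d + 1) = s - 1], multiplying [l] by [d + 1] turns [(-1) ^+ a * 2 * m] into
       [- (-1) ^+ a * m] modulo [s]; the leftover [(-1) ^+ a * m * s] enters the witness. *)
    apply: (lin (- (-1) ^+ a) (d%:Z + 1))%R; first by case: aE => ->; lia.
    exists ((d%:Z + 1) * (k - q * t%:Z) + (-1) ^+ a * m%:Z)%R.
    have -> : (l%:Z = k * (2 * d + 3)%:Z + (-1) ^+ a * (2 * m)%:Z
      - q * t%:Z * (2 * d + 3)%N%:Z)%R by rewrite e; ring.
    by rewrite !(PoszD, PoszM); ring.
  (* With [beta = 1] the coefficient [alpha] is read off from [l] directly. *)
  apply: (lin (- (-1) ^+ a * (d%:Z + 1)) 1)%R; first by case: aE => ->; lia.
  exists (k - q * t%:Z)%R.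
  have -> : (l%:Z = k * (2 * d + 3)%:Z - (-1) ^+ a * ((d + 1) * m)%:Z
    - q * t%:Z * (2 * d + 3)%N%:Z)%R by rewrite e; ring.
  by rewrite !(PoszD, PoszM); ring.
have [lam lamP lam_le] := ex_is_lambda_d1 upper.
exists lam; split=> // d14; apply/eqP; rewrite eqn_leq lam_le /=.
have m_gt0 : 0 < m by lia.
have n_ge3 : 3 <= n by have := dvdn_leq hn hsn; lia.
apply: (Ld1_span_lower_bound (Ordinal m_gt0, Ordinal hn) _ d14 _ lamP.1).
  exact: direct_bundleC.
by move=> u; apply: bundle_four_nbrs.
Qed.
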